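(* Let $0<c,c',\epsilon<1$ and $d\in\mathbb N$. For each prime $p$ let $N=N(p)\in\mathbb N$ with $\lim_{p\to\infty}N(p)=\infty$, and let $x_1,\dots,x_d,y_1,\dots,y_d,y'_1,\dots,y'_d\in\mathbb F_p$ (depending on $p$) with $x_1=1$. Let \[B=\Big\{\sum_{i=1}^d a_ix_i:\ a_i\in\mathbb Z,\ |a_i|\leq N\Big\}\subset\mathbb F_p\] be $6$-isolated. Suppose the generalized arithmetic progressions \[A=\Big\{\sum_{i=1}^d a_iy_i:\ a_i\in\mathbb Z,\ |a_i|\leq cN^{1-\epsilon}\Big\},\qquad A'=\Big\{\sum_{i=1}^d a_iy'_i:\ a_i\in\mathbb Z,\ |a_i|\leq c'N^{\epsilon}\Big\}\] are proper and satisfy $AA'\subset B$. Then there is a constant $C=C(c,c',d)$ such that, when $p$ is sufficiently large, for every $i\in\{1,\dots,d\}$ there exists a polynomial $f_i\in\mathbb Z[x]\setminus\{0\}$ of degree at most $d$ with $H(f_i)\leq C$ and $\overline f_i(x_i)=0$ in $\mathbb F_p$.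
   Context: $\mathbb F_p$ is the field with $p$ elements ($p$ prime); integers are viewed in $\mathbb F_p$ via reduction mod $p$. A generalized arithmetic progression (GAP) of rank $d$ is a set $x_0+\{\sum_{i=1}^d a_ix_i: a_i\in[0,N_i-1]\cap\mathbb Z\}$; it is proper if its size equals $N_1\cdots N_d$, i.e. distinct coefficient vectors give distinct elements. A symmetric set $\{\sum a_iz_i:|a_i|\le M_i\}$ is such a GAP with $N_i$ equal to the number of integers in $[-M_i,M_i]$; proper thus means the map $(a_i)\mapsto\sum a_iz_i$ is injective on that box. Such a GAP is $\kappa$-isolated if there is no nonzero $(a_1,\dots,a_d)\in\mathbb Z^d$ with $|a_i|\le\kappa N_i$ for all $i$ and $\sum_i a_ix_i=0$ (for $B$ above, $N_i=2N+1$). For $X,Y\subset\mathbb F_p$, $XY=\{xy:x\in X,y\in Y\}$. For $f\in\mathbb Z[x]$, $H(f)$ is the maximum absolute value of its coefficients and $\overline f$ its reduction mod $p$. *)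

(* Defs.v *)
From HB Require Import structures.
From mathcomp Require Export all_boot all_order all_algebra.
From mathcomp Require Export boolp classical_sets functions reals.
From mathcomp Require Export topology normedtype exp.

Set Implicit Arguments.
Unset Strict Implicit.
Unset Printing Implicit Defensive.

Import Order.TTheory GRing.Theory Num.Theory.

Local Open Scope classical_set_scope.
Local Open Scope ring_scope.

Definition int_comb (F : fieldType) (d : nat) (z : 'I_d -> F)
  (a : {ffun 'I_d -> int}) : F := \sum_(i < d) z i *~ a i.

Definition gap_box (R : realType) (d : nat) (M : 'I_d -> R) :
    set {ffun 'I_d -> int} :=
  [set a | forall i, `|a i|%:~R <= M i].

Definition sym_gap (R : realType) (F : fieldType) (d : nat) (z : 'I_d -> F)
  (M : 'I_d -> R) : set F := int_comb z @` gap_box M.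

Definition proper_gap (R : realType) (F : fieldType) (d : nat) (z : 'I_d -> F)
  (M : 'I_d -> R) : Prop := set_inj (gap_box M) (int_comb z).

(* [L i] is the side length N_i of the progression, i.e. the number of values *)
(* taken by the i-th coefficient: 2N+1 for the coefficients |a_i| <= N.       *)
Definition gap_isolated (R : realType) (F : fieldType) (d : nat) (kappa : R)
  (L : 'I_d -> nat) (z : 'I_d -> F) : Prop :=
  ~ exists a : {ffun 'I_d -> int},
      [/\ a != 0, forall i, `|a i|%:~R <= kappa * (L i)%:R
        & int_comb z a = 0].

Definition prodset (F : fieldType) (X Y : set F) : set F :=
  [set u * v | u in X & v in Y].

Definition poly_height (f : {poly int}) : nat :=
  (\max_(k < size f) `|(f`_k)%R|)%N.

(* Main.v *)
Require Import Defs.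
From mathcomp Require Import zify lra.

(** Since [B] is isolated, coefficients with respect to [x] depend bilinearly
    on the coefficients in [A] and [A'], so y_i y'_j = \sum_l T_ijl x_l for an
    integer tensor [T] with entries at most 4 / (c c'): only finitely many
    tensors occur, whatever [p] is.  Inverting the slice [T_1] (properness of
    [A'] makes it nonsingular) writes every ratio x_k = x_k / x_1 as u / v, with
    [u] and [v] bounded integer combinations of the y'_j.  For such a
    combination [w], the matrix S_w = \sum_j w_j T_{.j.} satisfies w y = S_w x,
    hence x_k S_v - S_u kills the nonzero vector [x], and f = det (X S_v - S_u)
    vanishes at x_k.  Its leading coefficient det S_v is nonzero by properness
    of [A]. *)

Set Implicit Arguments.
Unset Strict Implicit.
Unset Printing Implicit Defensive.

Import Order.TTheory GRing.Theory Num.Theory.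

Local Open Scope classical_set_scope.
Local Open Scope ring_scope.

(** * Determinant of a linear matrix pencil *)

(* Multiplying the pencil by the adjugate of [A] turns its determinant into a *)
(* characteristic polynomial evaluated at [\det A *: 'X].                     *)
Lemma size_det_pencil (R : idomainType) (n : nat) (A B : 'M[R]_n) :
  \det A != 0 ->
  size (\det ('X *: map_mx polyC A - map_mx polyC B)) = n.+1.
Proof.
move=> nzA; set P := _ - _.
have nz_adj : \det (\adj A) != 0.
  have := congr1 determinant (mul_adj_mx A).
  rewrite det_mulmx det_scalar => e; apply: contra_neq nzA => adj0.
  by apply/eqP; move: e; rewrite adj0 mul0r => /esym/eqP; rewrite expf_eq0 => /andP[].
have E : map_mx polyC (\adj A) *m P =
    map_mx (comp_poly (\det A *: 'X)) (char_poly_mx (\adj A *m B)).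
  rewrite mulmxBr -scalemxAr -!map_mxM mul_adj_mx.
  apply/matrixP => i j; rewrite !mxE comp_polyB comp_polyC; congr (_ - _).
  case: (i == j); last by rewrite !mulr0n mulr0 comp_poly0.
  by rewrite !mulr1n comp_polyX mulrC mul_polyC.
have := congr1 determinant E; rewrite det_mulmx !det_map_mx => {}E.
rewrite -(size_Cmul _ nz_adj) E size_comp_poly2 ?size_char_poly //.
by rewrite size_scale // size_polyX.
Qed.

(** * Bounds uniform over the finitely many tensors *)

Lemma ffun_box_bounded (I : finType) (K : nat) (P : {ffun I -> int} -> nat -> Prop) :
  (forall T m n, (m <= n)%N -> P T m -> P T n) -> (forall T, exists n, P T n) ->
  exists n, forall T : {ffun I -> int}, (forall i, `|T i| <= K)%N -> P T n.
Proof.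
move=> Pmono /choice[Q PQ].
(* Shifting by [K] codes the integers of $[-K,K]$ by the finite type with $2K+1$ elements, so a
   maximum over all codes exists. *)
pose D (t : {ffun I -> 'I_(K + K).+1}) := [ffun i => (t i)%:Z - K%:Z].
exists (\max_t Q (D t))%N => T leTK.
have -> : T = D [ffun i => inord `|T i + K%:Z|].
  by apply/ffunP => i; rewrite !ffunE inordK; have := leTK i; lia.
exact/Pmono/PQ/leq_bigmax.
Qed.

Definition slice (d : nat) (T : {ffun 'I_d * 'I_d * 'I_d -> int}) (i : 'I_d) :
  'M[int]_d := \matrix_(j, k) T (i, j, k).

Definition contract (d : nat) (T : {ffun 'I_d * 'I_d * 'I_d -> int})
  (w : 'rV[int]_d) : 'M[int]_d := \matrix_(i, k) \sum_j w 0 j * T (i, j, k).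

(** By Cramer's rule, pairing this row with $y'$ gives $x_k \det T_{i_0} / y_{i_0}$. *)
Definition adj_row (d : nat) (T : {ffun 'I_d * 'I_d * 'I_d -> int})
  (i0 k : 'I_d) : 'rV[int]_d := row k (\adj (slice T i0)).

(* The polynomial det (X S_v - S_u) attached to x_k, where [v] and [u] are the *)
(* rows [i0] and [k] of the adjugate of the slice [T_i0].                     *)
Definition elim_poly (d : nat) (T : {ffun 'I_d * 'I_d * 'I_d -> int})
    (i0 k : 'I_d) : {poly int} :=
  \det ('X *: map_mx polyC (contract T (adj_row T i0 i0))
        - map_mx polyC (contract T (adj_row T i0 k))).

Definition entries_le (n d : nat) (v : 'rV[int]_d) :=
  forall j, (`|(v 0 j)%R| <= n)%N.

Definition dissociated (F : fieldType) (n d : nat) (z : 'cV[F]_d) :=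
  forall v : 'rV[int]_d, entries_le n v -> v != 0 -> map_mx intr v *m z != 0.

(** A singular matrix must have a kernel vector short enough to contradict dissociation. The
    condition is vacuous when $\det A \neq 0$, so every integer matrix satisfies it for some [n]. *)
Definition small_kernel (n d : nat) (A : 'M[int]_d) :=
  \det A = 0 -> exists2 v : 'rV[int]_d, entries_le n v & v != 0 /\ v *m A = 0.

Lemma entries_leW (m n d : nat) (v : 'rV[int]_d) :
  (m <= n)%N -> entries_le m v -> entries_le n v.
Proof. by move=> lemn vm j; apply: leq_trans lemn. Qed.

Lemma entries_le_ex (d : nat) (v : 'rV[int]_d) : exists n, entries_le n v.
Proof.
by exists (\max_j `|(v 0 j)%R|)%N => j; rewrite (bigD1 j) //= leq_maxl.
Qed.

Lemma small_kernelW (m n d : nat) (A : 'M[int]_d) :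
  (m <= n)%N -> small_kernel m A -> small_kernel n A.
Proof.
by move=> lemn Am /Am[v vm ?]; exists v => //; apply: entries_leW vm.
Qed.

Lemma small_kernel_ex (d : nat) (A : 'M[int]_d) : exists n, small_kernel n A.
Proof.
have [A0|nzA] := eqVneq (\det A) 0; last by exists 0%N => /eqP; rewrite (negPf nzA).
have /det0P[v nzv vA] : \det A == 0 by apply/eqP.
by have [n vn] := entries_le_ex v; exists n => _; exists v.
Qed.

(** A short $v \neq 0$ with $vA = 0$ would give $a\,(vz) = vAx = 0$, a bounded relation among the
    entries of $z$. *)
Lemma det_neq0_dissociated (F : fieldType) (n d : nat) (A : 'M[int]_d)
    (x z : 'cV[F]_d) (a : F) :
  small_kernel n A -> dissociated n z -> a != 0 ->
  a *: z = map_mx intr A *m x -> \det A != 0.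
Proof.
move=> kA zd nza az; apply/eqP => /kA[v vn [nzv vA0]].
suff: a *: (map_mx intr v *m z) == 0.
  by rewrite scaler_eq0 (negPf nza) (negPf (zd _ vn nzv)).
by rewrite scalemxAr az mulmxA -map_mxM vA0 map_mx0 mul0mx.
Qed.

(* [n] dominates every quantity computed from [T] on which the proof relies,  *)
(* so that one bound serves the finitely many tensors at once.                *)
Definition tensor_bound (d : nat) (i0 : 'I_d)
    (T : {ffun 'I_d * 'I_d * 'I_d -> int}) (n : nat) : Prop :=
  [/\ (0 < n)%N, small_kernel n (slice T i0), entries_le n (adj_row T i0 i0),
      small_kernel n (contract T (adj_row T i0 i0)) &
      forall k, (poly_height (elim_poly T i0 k) <= n)%N].

Lemma tensor_bound_uniform (d : nat) (i0 : 'I_d) (K : nat) :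
  exists n, forall T : {ffun 'I_d * 'I_d * 'I_d -> int},
    (forall i, `|T i| <= K)%N -> tensor_bound i0 T n.
Proof.
apply: ffun_box_bounded => [T m n lemn [m0 ks ea kc ph]|T].
  split; first exact: leq_trans lemn.
  - exact: small_kernelW ks.
  - exact: entries_leW ea.
  - exact: small_kernelW kc.
  - by move=> k; apply: leq_trans lemn.
have [n1 ks] := small_kernel_ex (slice T i0).
have [n2 ea] := entries_le_ex (adj_row T i0 i0).
have [n3 kc] := small_kernel_ex (contract T (adj_row T i0 i0)).
pose n4 := (\max_k poly_height (elim_poly T i0 k))%N.
exists (1 + n1 + n2 + n3 + n4)%N; split; first lia.
- by apply: small_kernelW ks; lia.
- by apply: entries_leW ea; lia.
- by apply: small_kernelW kc; lia.
- move=> k; have : (poly_height (elim_poly T i0 k) <= n4)%N.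
    exact: (leq_bigmax (F := fun k => poly_height (elim_poly T i0 k))).
  lia.
Qed.

(** * Elimination of $y$ and $y'$ *)

Lemma elim_poly_root (F : fieldType) (d n : nat) (i0 k : 'I_d)
    (x y y' : 'cV[F]_d) (T : {ffun 'I_d * 'I_d * 'I_d -> int}) :
  x i0 0 = 1 -> dissociated n y -> dissociated n y' -> tensor_bound i0 T n ->
  (forall i j, y i 0 * y' j 0 = \sum_l x l 0 *~ T (i, j, l)) ->
  size (elim_poly T i0 k) = d.+1 /\
  (map_poly (intr : int -> F) (elim_poly T i0 k)).[x k 0] = 0.
Proof.
move=> x1 yd yd' [n0 ks ea kc _] mulyy'.
have nzy : y i0 0 != 0.
  (* As $n > 0$, the unit vector is among the combinations that dissociation controls. *)
  have := yd (delta_mx 0 i0); rewrite map_delta_mx -rowE => nz.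
  have /nz : entries_le n (delta_mx 0 i0) by move=> j; rewrite mxE; case: eqP => //=; case: eqP.
  have -> : delta_mx 0 i0 != 0 :> 'rV[int]_d.
    by apply/eqP => /rowP/(_ i0); rewrite !mxE !eqxx.
  by move=> /(_ isT); apply: contra => /eqP e; apply/eqP/rowP => j; rewrite ord1 !mxE.
have sliceE : y i0 0 *: y' = map_mx intr (slice T i0) *m x.
  apply/colP => j; rewrite !mxE mulyy'; apply: eq_bigr => l _.
  by rewrite !mxE -mulrzl.
have nzdet := det_neq0_dissociated ks yd' nzy sliceE.
pose form (w : 'rV[int]_d) : F := (map_mx intr w *m y') 0 0.
have contractE w : form w *: y = map_mx intr (contract T w) *m x.
  apply/colP => i; rewrite /form !mxE mulr_suml.
  under [RHS]eq_bigr => l _ do rewrite !mxE rmorph_sum /= mulr_suml.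
  rewrite exchange_big /=; apply: eq_bigr => j _; rewrite !mxE -mulrA [y' _ _ * _]mulrC mulyy'.
  rewrite mulr_sumr; apply: eq_bigr => l _.
  by rewrite intrM -mulrA [_%:~R * x l 0]mulrzl.
(* Cramer's rule for [sliceE]. As $x_{i_0} = 1$, comparing $l = k$ with $l = i_0$ cancels both the
   determinant and $y_{i_0}$. *)
have formE l : (\det (slice T i0))%:~R * x l 0 = y i0 0 * form (adj_row T i0 l).
  have : map_mx intr (\adj (slice T i0)) *m (y i0 0 *: y') =
      (\det (slice T i0))%:~R *: x.
    by rewrite sliceE mulmxA -map_mxM mul_adj_mx map_scalar_mx mul_scalar_mx.
  move/colP/(_ l); rewrite -scalemxAr !mxE => <-; congr (_ * _).
  by rewrite /form mxE; apply: eq_bigr => j _; rewrite !mxE.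
have xk_ratio : x k 0 * form (adj_row T i0 i0) = form (adj_row T i0 k).
  by apply: (mulfI nzy); rewrite mulrCA -formE x1 mulr1 -formE mulrC.
(* A zero row would kill a diagonal entry of $\mathrm{adj}(T_{i_0})\,T_{i_0} = \det(T_{i_0})\,I$. *)
have nzv : adj_row T i0 i0 != 0.
  apply/eqP => v0; have := mul_adj_mx (slice T i0).
  move/(congr1 (row i0)); rewrite row_mul -/(adj_row T i0 i0) v0 mul0mx.
  by move/rowP/(_ i0); rewrite !mxE eqxx mulr1n => /esym/eqP; rewrite (negPf nzdet).
have nzform : form (adj_row T i0 i0) != 0.
  apply: contra (yd' _ ea nzv) => /eqP f0.
  by apply/eqP/matrixP => i j; rewrite !ord1 [RHS]mxE; exact: f0.
have nzS := det_neq0_dissociated kc yd nzform (contractE _).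
split; first exact: size_det_pencil.
rewrite -horner_evalE -!det_map_mx.
(* [det0P] concerns row vectors, hence the transpose; $x$ is nonzero because its entry at [i0] is
   1. *)
apply/eqP; rewrite -det_tr; apply/det0P; exists x^T.
  by apply/eqP => /rowP/(_ i0)/eqP; rewrite !mxE x1 oner_eq0.
rewrite -trmx_mul; apply/eqP; rewrite trmx_eq0; apply/eqP.
set S := map_mx _ _.
have -> : S = x k 0 *: map_mx intr (contract T (adj_row T i0 i0))
    - map_mx intr (contract T (adj_row T i0 k)).
  apply/matrixP => i j; rewrite /S !mxE !rmorphB !rmorphM /= map_polyX !map_polyC /=.
  by rewrite !horner_evalE hornerX !hornerC.
by rewrite mulmxBl -scalemxAl -!contractE scalerA xk_ratio subrr.
Qed.

(** * Isolated progressions and the product tensor *)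

Lemma int_combB (F : fieldType) (d : nat) (z : 'I_d -> F) (a b : {ffun 'I_d -> int}) :
  int_comb z (a - b) = int_comb z a - int_comb z b.
Proof.
by rewrite -sumrB; apply: eq_bigr => i _; rewrite !ffunE mulrzBr.
Qed.

Lemma int_combMn (F : fieldType) (d : nat) (z : 'I_d -> F) (a : {ffun 'I_d -> int})
    (n : nat) :
  int_comb z (a *+ n) = int_comb z a *+ n.
Proof.
by rewrite -sumrMnl; apply: eq_bigr => i _; rewrite ffunMnE -mulr_natr natz mulrzA.
Qed.

Lemma int_comb0 (F : fieldType) (d : nat) (z : 'I_d -> F) : int_comb z 0 = 0.
Proof. by rewrite -(subrr 0) int_combB subrr. Qed.

Lemma sym_gap_multiple (R : realType) (F : fieldType) (d : nat) (z : 'I_d -> F)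
    (M : R) (i : 'I_d) (m : nat) :
  m%:R <= M -> sym_gap z (fun=> M) (z i *+ m).
Proof.
move=> mM; exists [ffun k => if k == i then m%:Z else 0].
  move=> k; rewrite ffunE; case: eqP => _ //.
  by rewrite normr0; apply: le_trans mM.
rewrite /int_comb (bigD1 i) //= ffunE eqxx big1 ?addr0 // => k /negPf ki.
by rewrite ffunE ki.
Qed.

Lemma gap_boxP (R : realType) (d N : nat) (b : {ffun 'I_d -> int}) :
  gap_box (fun=> N%:R : R) b <-> forall i, (`|b i| <= N)%N.
Proof.
have E i : ((`|b i|)%:~R <= N%:R :> R) = (`|b i| <= N)%N.
  by rewrite -[N%:R]/(N%:Z%:~R) ler_int -lez_nat abszE.
by split=> bN i; have := bN i; rewrite E.
Qed.

(* The representation of (n+1)b differs from nb + b by a relation whose       *)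
(* coefficients are at most 3N, which isolation forces to be trivial.         *)
Lemma isolated_multiple_le (R : realType) (F : fieldType) (d N n : nat)
    (x : 'I_d -> F) (b : {ffun 'I_d -> int}) :
  gap_isolated (6 : R) (fun=> (2 * N + 1)%N) x -> (forall i, `|b i| <= N)%N ->
  (forall m, (m <= n)%N -> sym_gap x (fun=> N%:R : R) (int_comb x b *+ m)) ->
  forall i, (n * `|b i| <= N)%N.
Proof.
move=> iso bN; elim: n => [|n IHn] nb i; first by rewrite mul0n.
have {}IHn := IHn (fun m lemn => nb m (leqW lemn)).
have [e /gap_boxP eN eb] := nb n.+1 (leqnn _).
suff e_eq : e = b *+ n.+1.
  by have := eN i; rewrite e_eq ffunMnE -mulr_natr natz abszM mulnC.
apply/eqP; rewrite -subr_eq0; apply/negPn/negP => nz; apply: iso.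
exists (e - b *+ n.+1); split=> // [k|]; last by rewrite int_combB int_combMn eb subrr.
rewrite -[6]/(6%:Z%:~R) -[(2 * N + 1)%:R]/((2 * N + 1)%N%:Z%:~R) -intrM ler_int.
have sum3 (u v w : int) : (`|u| <= N)%N -> (`|v| <= N)%N -> (`|w| <= N)%N ->
    `|u - (v + w)| <= 6%:Z * (2 * N + 1)%N%:Z by lia.
rewrite !ffunE ffunMnE -mulr_natr natz intS mulrDr mulr1.
by apply: sum3; rewrite // abszM mulnC.
Qed.

(** All products $(m y_i)(m' y'_j)$ with $m \le \lfloor M\rfloor$, $m' \le \lfloor M'\rfloor$ lie in
    $B$. The integers $mm'$ need not be consecutive, so [isolated_multiple_le] is applied twice:
    along $m$ with $m' = 1$, then along $m'$ starting from $\lfloor M\rfloor$ times the coefficient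
    vector. *)
Lemma product_tensor (R : realType) (F : fieldType) (d N : nat)
    (x y y' : 'I_d -> F) (M M' : R) :
  gap_isolated (6 : R) (fun=> (2 * N + 1)%N) x -> 1 <= M -> 1 <= M' ->
  prodset (sym_gap y (fun=> M)) (sym_gap y' (fun=> M'))
    `<=` sym_gap x (fun=> N%:R : R) ->
  exists T : {ffun 'I_d * 'I_d * 'I_d -> int},
    (forall i j, y i * y' j = \sum_l x l *~ T (i, j, l)) /\
    (forall t, Num.truncn M * Num.truncn M' * `|T t| <= N)%N.
Proof.
move=> iso M1 M1' sub.
have inB i j m m' : (m <= Num.truncn M)%N -> (m' <= Num.truncn M')%N ->
    sym_gap x (fun=> N%:R : R) ((y i * y' j) *+ (m * m')).
  move=> lem lem'; apply: sub; exists (y i *+ m).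
    apply: sym_gap_multiple; apply: (@le_trans _ _ (Num.truncn M)%:R); first by rewrite ler_nat.
    by have /andP[] := truncn_itv (le_trans ler01 M1).
  exists (y' j *+ m'); last by rewrite mulrnAl mulrnAr -mulrnA mulnC.
  apply: sym_gap_multiple; apply: (@le_trans _ _ (Num.truncn M')%:R); first by rewrite ler_nat.
  by have /andP[] := truncn_itv (le_trans ler01 M1').
have ge1 : (0 < Num.truncn M)%N by rewrite truncn_gt0.
have ge1' : (0 < Num.truncn M')%N by rewrite truncn_gt0.
have /choice[t tP] (ij : 'I_d * 'I_d) : exists b : {ffun 'I_d -> int},
    (forall l, `|b l| <= N)%N /\ int_comb x b = y ij.1 * y' ij.2.
  have [b /gap_boxP bN be] := inB ij.1 ij.2 1%N 1%N ge1 ge1'.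
  by exists b; split.
exists [ffun u => t u.1 u.2]; split=> [i j|[[i j] l]].
  by have [_ /= <-] := tP (i, j); apply: eq_bigr => l _; rewrite ffunE.
have [tN tE] := tP (i, j); rewrite ffunE /=.
have mt : forall l, (Num.truncn M * `|t (i, j) l| <= N)%N.
  apply: (isolated_multiple_le iso tN) => m lem.
  by rewrite tE; have := inB i j _ _ lem ge1'; rewrite muln1.
have E u : `|(t (i, j) *+ Num.truncn M) u|%N = (Num.truncn M * `|t (i, j) u|)%N.
  by rewrite ffunMnE -mulr_natr natz abszM mulnC.
rewrite mulnAC mulnC -E.
apply: (isolated_multiple_le iso) => [u|m lem]; first by rewrite E.
by rewrite int_combMn tE -mulrnA; apply: inB.
Qed.

(** * Properness, growth of $N$ and conclusion *)

Lemma proper_dissociated (R : realType) (F : fieldType) (d n : nat)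
    (z : 'I_d -> F) (M : R) :
  proper_gap z (fun=> M) -> n%:R <= M -> dissociated n (\col_i z i).
Proof.
move=> zp nM v vn; apply: contra => /eqP vz0.
have vn' : gap_box (fun=> n%:R : R) [ffun i => v 0 i].
  by apply/gap_boxP => k; rewrite ffunE; apply: vn.
have vM : gap_box (fun=> M) [ffun i => v 0 i] by move=> i; apply: le_trans (vn' i) nM.
have : [ffun i => v 0 i] = 0 :> {ffun 'I_d -> int}.
  apply: zp; rewrite ?inE //.
    by move=> i; rewrite ffunE normr0; apply: le_trans nM.
  rewrite int_comb0; have /matrixP/(_ 0 0) := vz0; rewrite !mxE => <-.
  by apply: eq_bigr => i _; rewrite !mxE ffunE mulrzl.
by move=> /ffunP v0; apply/eqP/rowP => i; have := v0 i; rewrite !ffunE mxE.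
Qed.

Lemma powR_nat_large (R : realType) (e Q : R) :
  0 < e -> exists n0, forall n, (n0 <= n)%N -> Q <= n%:R `^ e.
Proof.
(* Clipping at 0 makes $(Q'^{1/e})^e = Q'$ valid. *)
move=> e0; set Q' := Num.max Q 0.
exists (Num.truncn (Q' `^ e^-1)).+1 => n len.
have Q'0 : 0 <= Q' by rewrite le_max lexx orbT.
have QQ' : Q <= Q' by rewrite le_max lexx.
apply: le_trans QQ' _.
have root_le : Q' `^ e^-1 <= n%:R.
  by apply/ltW/(lt_le_trans (truncnS_gt _)); rewrite ler_nat.
have -> : Q' = (Q' `^ e^-1) `^ e by rewrite -powRrM mulVf ?gt_eqF // powRr1.
by apply: (ge0_ler_powR (ltW e0)) root_le; rewrite nnegrE ?powR_ge0.
Qed.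

Theorem theorem3 (R : realType) (c c' : R) (d : nat)
    (hc : 0 < c < 1) (hc' : 0 < c' < 1) (hd : (0 < d)%N) :
  exists C : R,
    forall (eps : R) (N : nat -> nat) (x y y' : forall p : nat, 'I_d -> 'F_p),
      0 < eps < 1 ->
      N @ within [set p | prime p] \oo --> \oo ->
      \forall p \near \oo, prime p ->
        let M : 'I_d -> R := fun=> (N p)%:R in
        let MA : 'I_d -> R := fun=> c * (N p)%:R `^ (1 - eps) in
        let MA' : 'I_d -> R := fun=> c' * (N p)%:R `^ eps in
        let B : set 'F_p := sym_gap (x p) M in
        let A : set 'F_p := sym_gap (y p) MA in
        let A' : set 'F_p := sym_gap (y' p) MA' in
        x p (Ordinal hd) = 1 ->
        gap_isolated (6 : R) (fun=> (2 * N p + 1)%N) (x p) ->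
        proper_gap (y p) MA ->
        proper_gap (y' p) MA' ->
        prodset A A' `<=` B ->
        forall i : 'I_d, exists f : {poly int},
          [/\ f != 0, (size f <= d.+1)%N, (poly_height f)%:R <= C
            & (map_poly (intr : int -> 'F_p) f).[x p i] = 0].
Proof.
have [/andP[c0 _] /andP[c0' _]] := (hc, hc').
have cc0 : 0 < c * c' by rewrite mulr_gt0.
(* The bound comes from $MA \cdot MA' = cc'N$ and the loss of a factor at most 2 in each truncation.
   It is fixed before [eps], [N] and [p]. *)
have [n nP] := tensor_bound_uniform (Ordinal hd) (Num.truncn (4 / (c * c'))).
exists n%:R => eps N x y y' /andP[e0 e1] NP.
have e10 : 0 < 1 - eps by rewrite subr_gt0.
(* The threshold $n+1$ makes both sides at least [n], for dissociation, and at least 1, which is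
   needed before any tensor is available. *)
have [n1 n1P] := powR_nat_large (n.+1%:R / c) e10.
have [n2 n2P] := powR_nat_large (n.+1%:R / c') e0.
have : \forall p \near \oo, prime p -> (1 + n1 + n2 <= N p)%N.
  exact: NP _ (nbhs_infty_ge (1 + n1 + n2)).
apply: filterS => p /= large pp x1 iso yp yp' sub i.
have {large} Nlarge : (1 + n1 + n2 <= N p)%N by apply: large.
set MA : R := c * (N p)%:R `^ (1 - eps) in yp sub.
set MA' : R := c' * (N p)%:R `^ eps in yp' sub.
have nMA : n.+1%:R <= MA by rewrite /MA mulrC -ler_pdivrMr // n1P //; lia.
have nMA' : n.+1%:R <= MA' by rewrite /MA' mulrC -ler_pdivrMr // n2P //; lia.
have MA1 : 1 <= MA by apply: le_trans nMA; rewrite ler1n.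
have MA1' : 1 <= MA' by apply: le_trans nMA'; rewrite ler1n.
have MAM : MA * MA' = c * c' * (N p)%:R.
  rewrite /MA /MA' mulrACA -powRD; last by rewrite subrK oner_eq0.
  by rewrite subrK powRr1.
have [T [TE TN]] := product_tensor iso MA1 MA1' sub.
have TK t : (`|T t| <= Num.truncn (4 / (c * c')))%N.
  (* For $m \ge 1$, $m < \lfloor m\rfloor + 1 \le 2\lfloor m\rfloor$. *)
  have half (m : R) : 1 <= m -> m <= 2 * (Num.truncn m)%:R.
    move=> m1; have := truncnS_gt m.
    have : 1 <= (Num.truncn m)%:R :> R by rewrite ler1n truncn_gt0.
    by rewrite -natr1; lra.
  have N0 : 0 < (N p)%:R :> R by rewrite ltr0n; lia.
  rewrite -ltnS -(ltr_nat R); apply: le_lt_trans (truncnS_gt _).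
  rewrite ler_pdivlMr // -(ler_pM2r N0) -mulrA -MAM.
  have := TN t; rewrite -(ler_nat R) !natrM => tn.
  have : MA * MA' <= 4 * ((Num.truncn MA)%:R * (Num.truncn MA')%:R).
    have -> : 4 = 2 * 2 :> R by rewrite -natrM.
    by rewrite [leRHS]mulrACA; apply: ler_pM; [exact: le_trans ler01 MA1|exact: le_trans ler01 MA1'| |]; rewrite ?half.
  move/(ler_wpM2l (ler0n R `|T t|%N)) => /le_trans; apply.
  by rewrite mulrCA ler_pM2l // mulrC.
have tb := nP _ TK.
have leM m : n.+1%:R <= m -> n%:R <= m :> R by apply: le_trans; rewrite ler_nat.
have [] := @elim_poly_root _ _ _ _ i (\col_i x p i) (\col_i y p i) (\col_i y' p i) T
  _ (proper_dissociated yp (leM _ nMA)) (proper_dissociated yp' (leM _ nMA')) tb _.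
- by rewrite mxE.
- by move=> j k; rewrite !mxE TE; apply: eq_bigr => l _; rewrite mxE.
rewrite mxE => sz root0; exists (elim_poly T (Ordinal hd) i); split=> //.
- by rewrite -size_poly_gt0 sz.
- by rewrite sz.
- by have [_ _ _ _ h] := tb; rewrite ler_nat.
Qed.
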